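(* Let $d,e\ge1$ be integers and let $I\subset S$ be the defining ideal of the weighted rational curve of type $(d,e)$. With respect to the term order $<_{\mathbf w}$ on $S$ defined in the context, the $2\times2$ minors of the $2\times(d+e-1)$ matrix $$M=\begin{bmatrix} x_0 & x_1 & \cdots & x_{d-2} & x_{d-1}^e & y_0 & \cdots & y_{e-2}\\ x_1 & x_2 & \cdots & x_{d-1} & y_0 & y_1 & \cdots & y_{e-1}\end{bmatrix}$$ form a Gröbner basis for $I$.
   Context: Let $k$ be a field and $S=k[x_0,\dots,x_{d-1},y_0,\dots,y_{e-1}]$. Let $\varphi:S\to k[s,t]$ be the $k$-algebra map with $\varphi(x_i)=s^{d-i}t^i$ for $0\le i\le d-1$ and $\varphi(y_i)=s^{e-1-i}t^{ed-(e-1)+i}$ for $0\le i\le e-1$. The defining ideal of the weighted rational curve of type $(d,e)$ is $I=\ker\varphi$. The columns of $M$ are, in order: $(x_{i-1},x_i)^T$ for $1\le i\le d-1$; then $(x_{d-1}^e,y_0)^T$; then $(y_{i-1},y_i)^T$ for $1\le i\le e-1$. Let $\mathbf w$ be the weight vector assigning weight $0$ to $x_{d-1}$ and weight $1$ to every other variable. The term order $<_{\mathbf w}$ first compares monomials by their $\mathbf w$-weight (larger weight is larger) and breaks ties with the graded reverse lexicographic order (by total degree in the variables, then reverse lexicographically) with $y_0>\cdots>y_{e-1}>x_0>\cdots>x_{d-1}$. *)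

(* Defs.v *)
From mathcomp Require Import all_boot all_order all_algebra.
From mathcomp Require Import mpoly.

Set Implicit Arguments.
Unset Strict Implicit.
Unset Printing Implicit Defensive.

Import GRing.Theory.

Local Open Scope ring_scope.

Section TermOrders.
Variable n : nat.
Implicit Types (m : 'X_{1..n}) (lt : rel 'X_{1..n}).

(* Strict form of a term order (total, multiplicative, with 1 the smallest
   monomial); monomials are written additively as exponent vectors. *)
Definition term_order lt : Prop :=
  [/\ irreflexive lt, transitive lt,
      forall m1 m2, m1 != m2 -> lt m1 m2 || lt m2 m1,
      forall m m1 m2, lt m1 m2 -> lt (m1 + m)%MM (m2 + m)%MM
    & forall m, m != 0%MM -> lt 0%MM m].

(* Graded reverse lexicographic order with 'X_0 > 'X_1 > ... > 'X_(n-1): in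
   equal degree, the smaller monomial is the one with the larger exponent at
   the last variable where the two differ.  The canonical order of mpoly on
   'X_{1..n} breaks ties lexicographically, so it cannot be used here. *)
Definition grevlex m1 m2 : bool :=
  (mdeg m1 < mdeg m2)%N ||
  (mdeg m1 == mdeg m2) &&
    [exists i : 'I_n, (m2 i < m1 i)%N &&
                      [forall j : 'I_n, (i < j)%N ==> (m1 j == m2 j)]].

Definition mweight (w : 'I_n -> nat) m : nat := (\sum_(i < n) w i * m i)%N.

Definition weight_order (w : 'I_n -> nat) lt m1 m2 : bool :=
  (mweight w m1 < mweight w m2)%N ||
  (mweight w m1 == mweight w m2) && lt m1 m2.

Lemma grevlex_term_order : term_order grevlex.
Proof.
split=> [m | m2 m1 m3 | m1 m2 | m m1 m2 | m].
- rewrite /grevlex ltnn eqxx /=; apply/negbTE/existsP => -[i].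
  by rewrite ltnn.
- case/orP=> [lt12 | /andP[/eqP e12 /existsP[i /andP[lti /forallP Hi]]]].
    case/orP=> [lt23 | /andP[/eqP e23 _]].
      by rewrite /grevlex (ltn_trans lt12 lt23).
    by rewrite /grevlex -e23 lt12.
  case/orP=> [lt23 | /andP[/eqP e23 /existsP[j /andP[ltj /forallP Hj]]]].
    by rewrite /grevlex e12 lt23.
  rewrite /grevlex e12 e23 eqxx ltnn /=; apply/existsP.
  case: (ltngtP i j) => [ij | ji | /val_inj eij].
  + exists j; rewrite (eqP (implyP (Hi j) ij)) ltj /=.
    apply/forallP=> l; apply/implyP=> jl.
    by rewrite (eqP (implyP (Hi l) (ltn_trans ij jl))) (implyP (Hj l)).
  + exists i; rewrite -(eqP (implyP (Hj i) ji)) lti /=.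
    apply/forallP=> l; apply/implyP=> il.
    by rewrite (eqP (implyP (Hi l) il)) (implyP (Hj l) (ltn_trans ji il)).
  + exists i; rewrite (ltn_trans _ lti) ?eij //=.
    apply/forallP=> l; apply/implyP=> jl.
    by rewrite (eqP (implyP (Hi l) _)) ?eij // (implyP (Hj l)).
- move=> ne12; rewrite /grevlex; case: ltngtP => //= _.
  have [i0 di0] : exists i : 'I_n, m1 i != m2 i.
    apply/existsP; apply: contraNT ne12; rewrite negb_exists => /forallP H.
    by apply/eqP/mnmP => i; apply/eqP; have := H i; rewrite negbK.
  case: (@arg_maxnP _ i0 (fun i => m1 i != m2 i) (@nat_of_ord n) di0) => i di maxi.
  have eqi (j : 'I_n) : (i < j)%N -> m1 j == m2 j.
    by move=> ij; apply: contraTT ij => /maxi; rewrite -leqNgt.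
  case: (ltngtP (m1 i) (m2 i)) di => // lti _; apply/orP; [right | left];
    apply/existsP; exists i; rewrite lti /=;
    apply/forallP=> j; apply/implyP => /eqi //.
  by rewrite eq_sym.
- rewrite /grevlex !mdegD ltn_add2r eqn_add2r.
  case/orP=> [-> // | /andP[-> /existsP[i /andP[lti /forallP Hi]]]].
  rewrite orbC /=; apply/orP; left; apply/existsP; exists i.
  rewrite !mnmDE ltn_add2r lti /=; apply/forallP=> j.
  by rewrite !mnmDE eqn_add2r.
- by move=> nz; rewrite /grevlex mdeg0 lt0n mdeg_eq0 nz.
Qed.

Lemma weight_term_order w lt : term_order lt -> term_order (weight_order w lt).
Proof.
have wD m m' : mweight w (m + m')%MM = (mweight w m + mweight w m')%N.
  rewrite /mweight -big_split; apply: eq_bigr => i _.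
  by rewrite mnmDE mulnDr.
case=> irr tr tot mul pos; split=> [m | m2 m1 m3 | m1 m2 ne | m m1 m2 | m nz].
- by rewrite /weight_order ltnn irr andbF.
- rewrite /weight_order.
  case/orP=> [lt12 | /andP[/eqP-> l12]]; case/orP=> [lt23 | /andP[/eqP<- l23]].
  + by rewrite (ltn_trans lt12 lt23).
  + by rewrite lt12.
  + by rewrite lt23.
  + by rewrite eqxx (tr _ _ _ l12 l23) orbT.
- by rewrite /weight_order; case: ltngtP => //= _; apply: tot.
- rewrite /weight_order !wD ltn_add2r eqn_add2r.
  by case/orP=> [-> // | /andP[-> /mul ->]]; rewrite orbT.
- have w0 : mweight w 0%MM = 0%N.
    by apply: big1 => i _; rewrite mnm0E muln0.
  by rewrite /weight_order w0; case: (mweight w m) => //=; apply: pos.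
Qed.

End TermOrders.

Section Groebner.
Variables (k : fieldType) (n : nat).
Local Notation S := {mpoly k[n]}.
Implicit Types (lt : rel 'X_{1..n}) (f g h : S) (A I : S -> Prop).

Definition ideal_span A h : Prop :=
  exists2 r : seq (S * S), (forall p, p \in r -> A p.2)
                         & h = \sum_(p <- r) p.1 * p.2.

Definition is_initial_monomial lt f (m : 'X_{1..n}) : Prop :=
  m \in msupp f /\ forall m', m' \in msupp f -> m' != m -> lt m' m.

(* The ideal generated by the initial monomials of the nonzero elements of A. *)
Definition initial_ideal lt A : S -> Prop :=
  ideal_span (fun h => exists f m,
    [/\ A f, is_initial_monomial lt f m & h = 'X_[m]]).

Definition groebner_basis lt (G : seq S) I : Prop :=
  (forall g, g \in G -> I g) /\
  (forall h, initial_ideal lt I h <-> initial_ideal lt (fun g => g \in G) h).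

End Groebner.

Section Minors.
Variables (R : comNzRingType) (c : nat).

Definition minors2 (M : 'M[R]_(2, c)) : seq R :=
  [seq \det (colsub (fun r : 'I_2 => if r == 0 then p.1 else p.2) M)
     | p : 'I_c * 'I_c <- enum {: 'I_c * 'I_c} & (p.1 < p.2)%N].

End Minors.

(* The variables of S are listed in decreasing grevlex order: the indices
   0, ..., e-1 are y_0, ..., y_(e-1), and e, ..., e+d-1 are x_0, ..., x_(d-1). *)
Section WeightedRationalCurve.
Variables (k : fieldType) (d e : nat).
Local Notation S := {mpoly k[e + d]}.

(* Indexed by nat; xvar i and yvar j are only meaningful for i < d and j < e. *)
Definition xvar (i : nat) : S :=
  if insub i is Some i' then 'X_(rshift e (i' : 'I_d)) else 0.

Definition yvar (j : nat) : S :=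
  if insub j is Some j' then 'X_(lshift d (j' : 'I_e)) else 0.

(* k[s,t] is {mpoly k[2]}, with s = 'X_0 and t = 'X_1. *)
Definition curve_param (v : 'I_(e + d)) : {mpoly k[2]} :=
  let s : {mpoly k[2]} := 'X_0 in let t : {mpoly k[2]} := 'X_1 in
  match split v with
  | inl j => s ^+ (e - 1 - j) * t ^+ (e * d - (e - 1) + j)
  | inr i => s ^+ (d - i) * t ^+ i
  end.

Definition curve_map (f : S) : {mpoly k[2]} := mmap (@mpolyC 2 k) curve_param f.

Definition curve_ideal (f : S) : Prop := curve_map f = 0.

(* Weight 0 for x_(d-1), weight 1 for every other variable. *)
Definition curve_weight (v : 'I_(e + d)) : nat :=
  match split v with
  | inl _ => 1%N
  | inr i => if i == (d - 1)%N :> nat then 0%N else 1%N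
  end.

Definition curve_order : rel 'X_{1..e + d} :=
  weight_order curve_weight (@grevlex (e + d)).

Definition curve_matrix : 'M[S]_(2, d + e - 1) :=
  \matrix_(i < 2, j < d + e - 1)
    if (j < d - 1)%N then xvar (j + i)
    else if j == (d - 1)%N :> nat then
      (if i == 0 then xvar (d - 1) ^+ e else yvar 0)
    else yvar (j - d + i).

End WeightedRationalCurve.

(* Main.v *)
(* Each minor is a difference of two monomials, with initial monomials
   x_i x_j (1 <= i <= j <= d-2), y_j x_i (i <= d-2) and y_i y_j (i <= j <= e-2).
   If f lies in the kernel, its initial monomial m has the same image in k[s,t]
   as a smaller monomial of f.  So it suffices that a monomial divisible by none
   of these quadrics is the least of its fibre.  Such a monomial is, up to a
   power of x_(d-1), of the form x_0^a x_c^b or y_(e-1)^a y_c^b with b <= 1.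
   The map preserves the number of x's plus e times the number of y's, and the
   grading deg x_i = d-1-i, deg y_j = -(j+1).  These two conserved quantities
   show that m has least weight in its fibre and that any monomial of the same
   weight involves only x's, resp. only y's besides x_(d-1); comparing the
   grading below the last variable where they differ excludes that it is
   grevlex-smaller than m. *)
From mathcomp Require Import all_boot all_order all_algebra.
From mathcomp Require Import mpoly.
Require Import Defs.
From mathcomp Require Import zify.
From Stdlib Require Import Classical_Prop.

Set Implicit Arguments.
Unset Strict Implicit.
Unset Printing Implicit Defensive.

Import GRing.Theory.

(** * Ideals spanned by a set, and comparison of initial ideals *)

Section IdealSpan.
Local Open Scope ring_scope.
Variables (k : fieldType) (n : nat).
Implicit Types (A : {mpoly k[n]} -> Prop) (h : {mpoly k[n]}).

Lemma ideal_span_sum A (r : seq ({mpoly k[n]} * {mpoly k[n]})) :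
    (forall p, p \in r -> ideal_span A p.2) ->
  ideal_span A (\sum_(p <- r) p.1 * p.2).
Proof.
elim: r => [|p r IHr] Ar; first by exists [::]; rewrite ?big_nil.
have [r1 Ar1 def_p] := Ar _ (mem_head p r).
have [|r2 Ar2 def_r] := IHr; first by move=> q rq; apply: Ar; rewrite inE rq orbT.
exists ([seq (p.1 * q.1, q.2) | q <- r1] ++ r2) => [q|].
  by rewrite mem_cat => /orP[/mapP[q' /Ar1 Aq' ->]|/Ar2].
rewrite big_cons big_cat /= -def_r def_p big_map mulr_sumr; congr (_ + _).
by apply: eq_bigr => q _; rewrite mulrA.
Qed.

(** Each generating monomial on the left is a monomial multiple of one on the right. Both inclusions
    of the theorem come from this. *)
Lemma initial_ideal_mono lt A A' :
    (forall f m, A f -> is_initial_monomial lt f m -> exists g m',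
       [/\ A' g, is_initial_monomial lt g m' & (m' <= m)%MM]) ->
  forall h, initial_ideal lt A h -> initial_ideal lt A' h.
Proof.
move=> sub h [r Ar ->]; apply: ideal_span_sum => p /Ar[f [m [Af fm ->]]].
have [g [m' [A'g gm' le_m'm]]] := sub f m Af fm.
exists [:: ('X_[(m - m')], 'X_[m'])] => [q|]; last first.
  by rewrite big_seq1 /= -mpolyXD submK.
by rewrite inE => /eqP-> /=; exists g, m'.
Qed.

End IdealSpan.

(** * Initial monomials of binomials *)

Section Binomials.
Local Open Scope ring_scope.
Variables (k : fieldType) (n : nat).

Lemma initial_binomial (lt : rel 'X_{1..n}) (a b : 'X_{1..n}) :
    irreflexive lt -> lt b a ->
  is_initial_monomial lt ('X_[a] - 'X_[b] : {mpoly k[n]}) a.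
Proof.
move=> irr ltba; have neq_ba: b != a by apply: contraTneq ltba => ->; rewrite irr.
split; first by rewrite mcoeff_msupp mcoeffB !mcoeffX eqxx (negPf neq_ba) subr0 oner_neq0.
move=> m; rewrite mcoeff_msupp mcoeffB !mcoeffX => + neq_ma.
rewrite [a == m]eq_sym (negPf neq_ma) sub0r oppr_eq0.
by case: (eqVneq b m) => [<- //|]; rewrite eqxx.
Qed.

Lemma initial_monomialN (lt : rel 'X_{1..n}) (f : {mpoly k[n]}) m :
  is_initial_monomial lt f m -> is_initial_monomial lt (- f) m.
Proof. by case=> fm ltm; split=> [|m']; rewrite (perm_mem (msuppN f)) //; apply: ltm. Qed.

End Binomials.

(** * Kernels of monomial maps *)

Section MonomialMaps.
Local Open Scope ring_scope.
Variables (k : fieldType) (n q : nat) (p : 'I_n -> 'X_{1..q}).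

Definition mimage (m : 'X_{1..n}) : 'X_{1..q} := (\sum_(v < n) p v *+ m v)%MM.

Lemma mmap1_mimage m : mmap1 (fun v => 'X_[p v]) m = 'X_[mimage m] :> {mpoly k[q]}.
Proof.
rewrite /mimage (big_morph _ (@mpolyXD q k) (mpolyX0 _ _)).
by apply: eq_bigr => v _; rewrite mpolyXn.
Qed.

(* The coefficient of the image of [m] must cancel, so another monomial lies
   in its fibre. *)
Lemma monomial_map_kernel (f : {mpoly k[n]}) m :
    mmap (@mpolyC q k) (fun v => 'X_[p v]) f = 0 -> m \in msupp f ->
  exists2 m', m' \in msupp f & m' != m /\ mimage m' = mimage m.
Proof.
move=> f0 fm; pose other m' := (m' != m) && (mimage m' == mimage m).
case: (altP (@hasP _ other (msupp f))).
  by case=> m' fm' /andP[ne /eqP eq]; exists m'.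
move=> /hasPn none; move: (fm); rewrite mcoeff_msupp => /eqP[].
have /(congr1 (mcoeff (mimage m))) := f0; rewrite mcoeff0 => <-.
rewrite /mmap raddf_sum /= (bigD1_seq m) ?msupp_uniq //= big_seq_cond big1 ?addr0.
  by rewrite mmap1_mimage mul_mpolyC mcoeffZ mcoeffX eqxx mulr1.
move=> m' /andP[/none + ne]; rewrite /other ne mmap1_mimage mul_mpolyC mcoeffZ mcoeffX.
by move=> /= /negPf->; rewrite mulr0.
Qed.

End MonomialMaps.

(** * Linear weights on exponent vectors *)

Section Weights.
Variable n : nat.
Implicit Types (w : 'I_n -> nat) (m : 'X_{1..n}).

Lemma eq_mweight w1 w2 m : w1 =1 w2 -> mweight w1 m = mweight w2 m.
Proof. by move=> eqw; apply: eq_bigr => v _; rewrite eqw. Qed.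

Lemma leq_mweight w1 w2 m : (forall v, w1 v <= w2 v) -> mweight w1 m <= mweight w2 m.
Proof. by move=> lew; apply: leq_sum => v _; rewrite leq_mul2r lew orbT. Qed.

Lemma mweight_funD w1 w2 m :
  mweight (fun v => w1 v + w2 v) m = mweight w1 m + mweight w2 m.
Proof. by rewrite /mweight -big_split; apply: eq_bigr => v _; rewrite mulnDl. Qed.

Lemma mweight_funM c w m : mweight (fun v => c * w v) m = c * mweight w m.
Proof. by rewrite /mweight big_distrr; apply: eq_bigr => v _; rewrite /= mulnA. Qed.

Lemma mweightD w m1 m2 : mweight w (m1 + m2)%MM = mweight w m1 + mweight w m2.
Proof. by rewrite /mweight -big_split; apply: eq_bigr => v _; rewrite mnmDE mulnDr. Qed.

Lemma mweightMn w m c : mweight w (m *+ c)%MM = mweight w m * c.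
Proof. by rewrite /mweight big_distrl; apply: eq_bigr => v _; rewrite /= mulmnE mulnA. Qed.

Lemma mweight_pick (i : 'I_n) m : mweight (fun v => v == i :> nat) m = m i.
Proof.
rewrite /mweight (bigD1 i) //= eqxx mul1n big1 ?addn0 // => v /negPf.
by rewrite -(inj_eq val_inj) => ->.
Qed.

Lemma mweight_gt0 w m : 0 < mweight w m -> exists2 i, 0 < w i & 0 < m i.
Proof.
rewrite lt0n sum_nat_eq0 negb_forall => /existsP[i].
by rewrite implyTb muln_eq0 negb_or -!lt0n => /andP[]; exists i.
Qed.

(* The weights of the variables above [i] contribute equally to both sides. *)
Lemma mweight_head w m1 m2 (i : 'I_n) :
    (forall j : 'I_n, i < j -> m1 j = m2 j) -> mweight w m1 = mweight w m2 ->
  mweight (fun v => if v <= i then w v else 0) m1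
  = mweight (fun v => if v <= i then w v else 0) m2.
Proof.
move=> eqm.
have split m : mweight w m = mweight (fun v => if v <= i then w v else 0) m
                             + mweight (fun v => if v <= i then 0 else w v) m.
  by rewrite -mweight_funD; apply: eq_mweight => v; case: ifP; rewrite ?addn0.
rewrite !split (_ : mweight (fun v : 'I_n => if v <= i then 0 else w v) m1
  = mweight (fun v : 'I_n => if v <= i then 0 else w v) m2); first by move/addIn.
by apply: eq_bigr => v _; case: (leqP v i) => // /eqm->.
Qed.

(** Indexing by [nat] leaves index shifts to plain arithmetic; an index out of range gives the zero
    vector. *)
Definition mvar (i : nat) : 'X_{1..n} := [multinom nat_of_bool (v == i :> nat) | v < n].

Lemma mvarE i v : mvar i v = (v == i :> nat).
Proof. exact: mnmE. Qed.

Lemma mvar_ord (i : 'I_n) : mvar i = U_(i)%MM.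
Proof. by apply/mnmP=> j; rewrite mvarE mnm1E eq_sym. Qed.

Lemma mweight_mvar (w : nat -> nat) i : i < n -> mweight (fun v => w v) (mvar i) = w i.
Proof.
move=> lt_in; rewrite -[i]/(val (Ordinal lt_in)) mvar_ord /mweight.
rewrite (bigD1 (Ordinal lt_in)) //= mnm1E eqxx muln1 big1 ?addn0 // => j.
by rewrite mnm1E eq_sym => /negPf->; rewrite muln0.
Qed.

Lemma mdeg_mvar i : i < n -> mdeg (mvar i) = 1.
Proof. by move=> lt_in; rewrite -[i]/(val (Ordinal lt_in)) mvar_ord mdeg1. Qed.

Lemma mdeg_mweight m : mdeg m = mweight (fun=> 1) m.
Proof. by rewrite mdegE; apply: eq_bigr => v _; rewrite mul1n. Qed.

Lemma mvar_pair_le (i j : 'I_n) m :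
  i <= j -> 0 < m i -> 0 < m j -> (i = j :> nat -> 1 < m i) ->
  (mvar i + mvar j <= m)%MM.
Proof.
move=> le_ij mi mj mij; apply/mnm_lepP=> v; rewrite mnmDE !mvarE.
have [/eqP/val_inj->|/eqP] := boolP (v == i :> nat);
 have [/eqP/val_inj ?|/eqP] := boolP (v == j :> nat); subst; try lia.
Qed.

(** Two factors from [P], distinct or equal, would already form a forbidden divisor; hence the case
    i = j in the hypothesis. *)
Lemma mweight_pair_free (P : pred nat) m :
    (forall i j : 'I_n, P i -> P j -> i <= j -> ~~ (mvar i + mvar j <= m)%MM) ->
  mweight (fun v => P v) m <= 1.
Proof.
move=> free; rewrite leqNgt; apply/negP=> gt1.
have [i Pi mi] := mweight_gt0 (ltnW gt1); move: Pi; rewrite lt0b => Pi.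
have mi1 : m i = 1.
  apply/eqP; rewrite eqn_leq mi andbT leqNgt; apply: contraT.
  by rewrite negbK => mi2; have /negP[] := free i i Pi Pi (leqnn _); apply: mvar_pair_le.
move: gt1; rewrite /mweight (bigD1 i) //= Pi mul1n mi1 ltnS lt0n sum_nat_eq0.
rewrite negb_forall => /existsP[j]; rewrite negb_imply => /andP[ne_ji].
rewrite muln_eq0 negb_or -!lt0n lt0b => /andP[Pj mj].
have neq : (j != i :> nat) by [].
case: (leqP i j) => [le_ij|/ltnW le_ji].
  by have /negP[] := free i j Pi Pj le_ij; apply: mvar_pair_le => //; lia.
by have /negP[] := free j i Pj Pi le_ji; apply: mvar_pair_le => //; lia.
Qed.

End Weights.

(** * Fibres of the parametrisation and their least monomials *)

Section Curve.
Variables d e : nat.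
Hypotheses (d_gt0 : 0 < d) (e_gt0 : 0 < e).

(** Exponents of s and t in the image of the variable at position v, which is y_v for v < e and
    x_(v-e) otherwise. *)
Definition spow (v : nat) := if v < e then e - 1 - v else d - (v - e).
Definition tpow (v : nat) := if v < e then e * d - (e - 1) + v else v - e.

Definition off_last (v : nat) := if v < e + d - 1 then 1 else 0.

Lemma curve_orderE (m1 m2 : 'X_{1..e + d}) :
  let W m := mweight (fun v => off_last v) m in
  curve_order m1 m2 = (W m1 < W m2) || (W m1 == W m2) && grevlex m1 m2.
Proof.
have weightE (v : 'I_(e + d)) : curve_weight v = off_last v.
  rewrite /curve_weight /off_last; case: splitP => i ->; have := ltn_ord i.
    by case: ifP; lia.
  by case: eqP => ?; case: ifP; lia.
by rewrite /= /curve_order /weight_order !(eq_mweight _ weightE).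
Qed.

(* The hypotheses say that [m] is divisible by none of the initial monomials
   x_i x_j, y_i x_j, y_i y_j of the minors. *)
Lemma standard_least (m m' : 'X_{1..e + d}) :
    (forall i j : 'I_(e + d), e < i -> i <= j -> j < e + d - 1 ->
       ~~ (mvar _ i + mvar _ j <= m)%MM) ->
    (forall i j : 'I_(e + d), i < e -> e <= j -> j < e + d - 1 ->
       ~~ (mvar _ i + mvar _ j <= m)%MM) ->
    (forall i j : 'I_(e + d), i <= j -> j < e - 1 ->
       ~~ (mvar _ i + mvar _ j <= m)%MM) ->
    mweight (fun v => spow v) m' = mweight (fun v => spow v) m ->
    mweight (fun v => tpow v) m' = mweight (fun v => tpow v) m ->
  ~~ curve_order m' m.
Proof.
move=> freeXX freeXY freeYY eqS eqT.
(* wA and wB count the x's other than x_(d-1) and the y's; wX and wY are the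
   contributions of the x's and the y's to the grading deg x_i = d-1-i,
   deg y_j = -(j+1), which is constant on fibres. *)
pose wA (v : nat) := if (e <= v) && (v < e + d - 1) then 1 else 0.
pose wB (v : nat) := if v < e then 1 else 0.
pose wP (v : nat) := if v == e + d - 1 then 1 else 0.
pose wX (v : nat) := if e <= v then e + d - 1 - v else 0.
pose wY (v : nat) := if v < e then v.+1 else 0.
pose wt (w : nat -> nat) (x : 'X_{1..e + d}) := mweight (fun v => w v) x.
have wtD w1 w2 x : wt w1 x + wt w2 x = wt (fun v => w1 v + w2 v) x.
  by rewrite /wt mweight_funD.
have wtM c w x : c * wt w x = wt (fun v => c * w v) x.
  by rewrite /wt mweight_funM.
have wt_eq w1 w2 x : (forall v, v < e + d -> w1 v = w2 v) -> wt w1 x = wt w2 x.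
  by move=> eqw; apply: eq_mweight => v; apply: eqw.
have wt_le w1 w2 x : (forall v, v < e + d -> w1 v <= w2 v) -> wt w1 x <= wt w2 x.
  by move=> lew; apply: leq_mweight => v; apply: lew.
have eqN : wt wA m' + wt wP m' + e * wt wB m' = wt wA m + wt wP m + e * wt wB m.
  (* Each x_i maps to degree d and each y_j to degree ed; e <= ed makes the truncated subtraction in
     [tpow] exact. *)
  have N x : d * (wt wA x + wt wP x + e * wt wB x) = wt spow x + wt tpow x.
    rewrite !(wtD, wtM); apply: wt_eq => v ltv; rewrite /wA /wP /wB /spow /tpow.
    by have := leq_pmulr e d_gt0; do ![case: ifP => /= ?]; nia.
  by apply/eqP; rewrite -(eqn_pmul2l d_gt0) !N /wt eqS eqT.
have eqXY : wt wX m' + wt wY m = wt wX m + wt wY m'.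
  (* The exponent of s is the first invariant plus the grading: d-i = 1 + (d-1-i) and e-1-j = e -
     (j+1). *)
  have N x : wt wA x + wt wP x + e * wt wB x + wt wX x = wt spow x + wt wY x.
    rewrite !(wtD, wtM); apply: wt_eq => v ltv; rewrite /wA /wP /wB /wX /wY /spow.
    by do ![case: ifP => /= ?]; nia.
  by move: (N m) (N m') eqS eqN; rewrite -!/(wt _ _); lia.
have leAX x : wt wA x <= wt wX x.
  by apply: wt_le => v; rewrite /wA /wX; do ![case: ifP => /= ?]; lia.
have leXA x : wt wX x <= (d - 1) * wt wA x.
  by rewrite wtM; apply: wt_le => v; rewrite /wA /wX; do ![case: ifP => /= ?]; nia.
have leBY x : wt wB x <= wt wY x.
  by apply: wt_le => v; rewrite /wB /wY; do ![case: ifP => /= ?]; lia.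
have leYB x : wt wY x <= e * wt wB x.
  by rewrite wtM; apply: wt_le => v; rewrite /wB /wY; do ![case: ifP => /= ?]; nia.
(* [m] involves at most one of x_1, ..., x_(d-2), and at most one of
   y_0, ..., y_(e-2), to the first power. *)
pose Q := [pred v | (e < v) && (v < e + d - 1)]; pose Q' := [pred v | v < e - 1].
have leQ : wt (fun v => Q v) m <= 1.
  by apply: mweight_pair_free => i j /= /andP[? _] /andP[_ ?] ?; apply: freeXX.
have leQ' : wt (fun v => Q' v) m <= 1.
  by apply: mweight_pair_free => i j /= _ ? ?; apply: freeYY.
(* x_0 attains the maximum d-1 of [wX], and x_1, ..., x_(d-2) miss it by at most d-2. Likewise
   below, y_(e-1) attains the maximum e of [wY]. *)
have leAQ : (d - 1) * wt wA m <= wt wX m + (d - 2) * wt (fun v => Q v) m.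
  rewrite !(wtD, wtM); apply: wt_le => v ltv; rewrite /wA /wX /Q /=.
  by do ![case: ifP => /= ?]; nia.
have leBQ : e * wt wB m <= wt wY m + (e - 1) * wt (fun v => Q' v) m.
  rewrite !(wtD, wtM); apply: wt_le => v ltv; rewrite /wB /wY /Q' /=.
  by do ![case: ifP => /= ?]; nia.
have AB0 : wt wA m = 0 \/ wt wB m = 0.
  have [|A_gt0] := posnP (wt wA m); first by left.
  have [|B_gt0] := posnP (wt wB m); first by right.
  have [j wj mj] := mweight_gt0 A_gt0; have [i wi mi] := mweight_gt0 B_gt0.
  move: wj wi; rewrite /wA /wB; case: ifP => // /andP[le_ej ltj] _.
  case: ifP => // lt_ie _; have /negP[] := freeXY i j lt_ie le_ej ltj.
  by apply: mvar_pair_le => //; lia.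
have head w (i : 'I_(e + d)) : (forall j : 'I_(e + d), i < j -> m' j = m j) ->
    wt w m' = wt w m ->
    wt (fun v => if v <= i then w v else 0) m'
    = wt (fun v => if v <= i then w v else 0) m.
  exact: mweight_head.
have pick (i : 'I_(e + d)) (x : 'X_{1..e + d}) : x i = wt (fun v => v == i) x.
  by rewrite /wt mweight_pick.
have Wsum (x : 'X_{1..e + d}) :
    mweight (fun v => off_last v) x = wt wA x + wt wB x.
  rewrite -[LHS]/(wt off_last x).
  by rewrite wtD; apply: wt_eq => v; rewrite /off_last /wA /wB; do ![case: ifP => /= ?]; lia.
rewrite curve_orderE /= !Wsum /grevlex.
have degE x : mdeg x = wt wA x + wt wB x + wt wP x.
  rewrite mdeg_mweight -[LHS]/(wt (fun=> 1) x) !wtD; apply: wt_eq => v.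
  by rewrite /wA /wB /wP; do ![case: ifP => /= ?]; lia.
rewrite !degE; apply/negP=> lt_m'm.
have leW : wt wA m' + wt wB m' <= wt wA m + wt wB m.
  by case/orP: lt_m'm => [/ltnW|/andP[/eqP-> _]].
(* If [wA] vanishes on m, so does [wX], and e wB(m) <= wY(m) + e-1 <= wY(m') + e-1 < e (wB(m') + 1).
   Thus wB(m) <= wB(m'), and [leW] forces both equalities. The case where [wB] vanishes is
   symmetric, with d-1 in place of e. *)
have [eqA eqB] : wt wA m' = wt wA m /\ wt wB m' = wt wB m.
  have leQd : (d - 2) * wt (fun v => Q v) m <= d - 2
    by rewrite -[leqRHS]muln1 leq_mul2l leQ orbT.
  have leQe : (e - 1) * wt (fun v => Q' v) m <= e - 1
    by rewrite -[leqRHS]muln1 leq_mul2l leQ' orbT.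
  case: AB0 => [A0|B0].
    have : e * wt wB m < e * (wt wB m').+1.
      by have := leXA m; have := leYB m'; rewrite mulnS; rewrite A0; lia.
    by rewrite ltn_pmul2l // ltnS; lia.
  have [A0|A_gt0] := posnP (wt wA m).
    by split; lia.
  (* For d = 1 the only x is x_(d-1), which [wA] does not count. *)
  have d1_gt0 : 0 < d - 1 by have := leAX m; have := leXA m; nia.
  have : (d - 1) * wt wA m < (d - 1) * (wt wA m').+1.
    by have := leXA m'; have := leYB m; rewrite mulnS; rewrite B0; lia.
  by rewrite ltn_pmul2l // ltnS; lia.
have eq_P : wt wP m' = wt wP m by lia.
(* Weight and degree now agree, so only the reverse lexicographic tie-break remains: i is the last
   place of difference, and m' has the larger exponent there. *)
move: lt_m'm; rewrite eqA eqB eq_P !ltnn !eqxx /= => /existsP[i /andP[lt_mi]].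
move=> /forallP eq_above; have {}eq_above (j : 'I_(e + d)) : i < j -> m' j = m j.
  by move=> lt_ij; apply/eqP/(implyP (eq_above j)).
have lt_i := ltn_ord i; move: lt_mi; rewrite !pick => lt_mi.
case: (ltnP i e) => [lt_ie|le_ei].
  have le_iB : wt (fun v => v == i) m' <= wt wB m'.
    by apply: wt_le => v; rewrite /wB; case: eqP => [->|] //; rewrite lt_ie.
  have A0 : wt wA m = 0 by lia.
  have eqY : wt wY m' = wt wY m by have := leXA m; have := leXA m'; lia.
  have headB := head wB i eq_above eqB; have headY := head wY i eq_above eqY.
  have B_split x : wt (fun v => if v <= i then wB v else 0) x
      = wt (fun v => v == i) x + wt (fun v => v < i) x.
    rewrite wtD; apply: wt_eq => v _; rewrite /wB.
    by case: (ltngtP v i) => ltv /=; try case: ifP; lia.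
  have Y_ub : wt (fun v => if v <= i then wY v else 0) m
      <= i.+1 * wt (fun v => v == i) m + i * wt (fun v => v < i) m.
    rewrite !(wtM, wtD); apply: wt_le => v _; rewrite /wY.
    by case: (ltngtP v i) => ltv /=; try case: ifP; lia.
  have Y_lb : i.+1 * wt (fun v => v == i) m' + wt (fun v => v < i) m'
      <= wt (fun v => if v <= i then wY v else 0) m'.
    rewrite !(wtM, wtD); apply: wt_le => v _; rewrite /wY.
    by case: (ltngtP v i) => ltv /=; try case: ifP; lia.
  (* So m has at most one y before y_i, and m' can only exceed m by one y_i, replacing that
     variable. This adds i+1 to [wY] and removes at most i. *)
  have lt_i1 : wt (fun v => v < i) m <= wt (fun v => Q' v) m.
    by apply: wt_le => v _; rewrite /Q' /=; lia.
  by rewrite !B_split in headB; nia.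
have ne_iP : i != e + d - 1 :> nat.
  by apply: contraTneq lt_mi => eqi; rewrite eqi -leqNgt; move: eq_P; rewrite /wP /wt => ->.
have lt_iA : i < e + d - 1 by lia.
have le_iA : wt (fun v => v == i) m' <= wt wA m'.
  by apply: wt_le => v; rewrite /wA; case: eqP => [->|] //; rewrite lt_iA le_ei.
have B0 : wt wB m = 0 by lia.
have eqX : wt wX m' = wt wX m by have := leYB m; have := leYB m'; lia.
have headA := head wA i eq_above eqA; have headX := head wX i eq_above eqX.
(* Weighting x_c by c rather than d-1-c makes x_0 contribute nothing; its exponent in m is not
   bounded by [leQ]. *)
pose wK (v : nat) := if v <= i then v - e else 0.
have eqK : wt wK m' = wt wK m.
  have K x : wt wK x + wt (fun v => if v <= i then wX v else 0) x
      = (d - 1) * wt (fun v => if v <= i then wA v else 0) x.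
    rewrite !(wtM, wtD); apply: wt_eq => v _; rewrite /wK /wX /wA.
    by do ![case: ifP => /= ?]; lia.
  by move: (K m) (K m'); rewrite headA headX; lia.
have K_lb : (i - e) * wt (fun v => v == i) m' <= wt wK m'.
  rewrite wtM; apply: wt_le => v _; rewrite /wK.
  by case: (ltngtP v i) => ltv /=; rewrite ?muln0 ?muln1; nia.
have K_ub : wt wK m <= (i - e) * wt (fun v => v == i) m
    + (i - e - 1) * wt (fun v => (e < v) && (v < i)) m.
  rewrite !(wtM, wtD); apply: wt_le => v _; rewrite /wK.
  by case: (ltngtP v i) => ltv /=; case: ltnP => ? /=; rewrite ?muln0 ?muln1; nia.
(* At x_0 the weight [wK] carries no information, but there [headA] already equates the two
   exponents. *)
have [eq_ie|lt_ei] : i = e :> nat \/ e < i by lia.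
  have A_head x : wt (fun v => if v <= i then wA v else 0) x = wt (fun v => v == i) x.
    apply: wt_eq => v _; rewrite /wA.
    by case: (ltngtP v i) => ltv /=; try case: ifP; lia.
  by move: headA; rewrite !A_head; lia.
have le_Q : wt (fun v => v == i) m + wt (fun v => (e < v) && (v < i)) m
    <= wt (fun v => Q v) m.
  by rewrite wtD; apply: wt_le => v _; rewrite /Q /=; lia.
nia.
Qed.

(** * Columns of the matrix and the larger term of each minor *)

Definition top_mon (c : nat) : 'X_{1..e + d} :=
  if c < d - 1 then mvar _ (e + c)
  else if c == d - 1 then (mvar _ (e + d - 1) *+ e)%MM else mvar _ (c - d).

Definition bot_mon (c : nat) : 'X_{1..e + d} :=
  if c < d - 1 then mvar _ (e + c).+1 else mvar _ (c - (d - 1)).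

(** Going down a column trades one s for one t, also in column d-1, where s^e t^(e(d-1)) becomes
    s^(e-1) t^(ed-e+1). Hence the two terms of a minor have equal images. *)
Lemma top_bot_spow c : c < d + e - 1 ->
  mweight (fun v => spow v) (top_mon c) = (mweight (fun v => spow v) (bot_mon c)).+1.
Proof.
move=> ltc; rewrite /top_mon /bot_mon.
case: ifP => ltc1; last case: eqP => eqc.
- by rewrite !mweight_mvar /spow; do ?[case: ifP]; lia.
- by rewrite mweightMn !mweight_mvar /spow; do ?[case: ifP]; nia.
by rewrite !mweight_mvar /spow; do ?[case: ifP]; lia.
Qed.

Lemma top_bot_tpow c : c < d + e - 1 ->
  mweight (fun v => tpow v) (bot_mon c) = (mweight (fun v => tpow v) (top_mon c)).+1.
Proof.
move=> ltc; rewrite /top_mon /bot_mon.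
case: ifP => ltc1; last case: eqP => eqc.
- by rewrite !mweight_mvar /tpow; do ?[case: ifP]; lia.
- by rewrite mweightMn !mweight_mvar /tpow; do ?[case: ifP]; nia.
by rewrite !mweight_mvar /tpow; do ?[case: ifP]; lia.
Qed.

Lemma curve_order_irr : irreflexive (@curve_order d e).
Proof. by have [] := weight_term_order (@curve_weight d e) (@grevlex_term_order (e + d)). Qed.

Lemma curve_order_deg (m1 m2 : 'X_{1..e + d}) :
    mweight (fun v => off_last v) m1
    < mweight (fun v => off_last v) m2 ->
  curve_order m1 m2.
Proof. by rewrite curve_orderE /= => ->. Qed.

Lemma curve_order_last (m1 m2 : 'X_{1..e + d}) (i : 'I_(e + d)) :
    mweight (fun v => off_last v) m1
    = mweight (fun v => off_last v) m2 ->
    mdeg m1 = mdeg m2 -> m2 i < m1 i ->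
    (forall j : 'I_(e + d), i < j -> m1 j = m2 j) ->
  curve_order m1 m2.
Proof.
move=> eqW eqD lt_i eq_above; rewrite curve_orderE /= eqW ltnn eqxx /grevlex eqD ltnn eqxx /=.
apply/existsP; exists i; rewrite lt_i; apply/forallP=> j; apply/implyP=> lt_ij.
by rewrite eq_above.
Qed.

Lemma lead_xx i j : 0 < i -> i <= j -> j < d - 1 ->
  curve_order (top_mon i.-1 + bot_mon j)%MM (top_mon j + bot_mon i.-1)%MM.
Proof.
move=> i_gt0 le_ij ltj; rewrite /top_mon /bot_mon ltj (_ : i.-1 < d - 1); last lia.
(* The smaller term contains x_(j+1), the last variable where the terms differ. If it is x_(d-1), of
   weight 0, the weight alone decides. *)
have [lt_j1|eq_j1] : (e + j).+1 < e + d - 1 \/ (e + j).+1 = e + d - 1 by lia.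
  have lt_o : (e + j).+1 < e + d by lia.
  apply: (@curve_order_last _ _ (Ordinal lt_o)).
  - by rewrite !mweightD !mweight_mvar /off_last; do ?[case: ifP]; lia.
  - by rewrite !mdegD !mdeg_mvar; lia.
  - by rewrite !mnmDE !mvarE /=; lia.
  by move=> v /= ltv; rewrite !mnmDE !mvarE; lia.
by apply: curve_order_deg; rewrite !mweightD !mweight_mvar /off_last; do ?[case: ifP]; lia.
Qed.

Lemma lead_xy i j : i < d - 1 -> j < e ->
  curve_order (top_mon (d - 1 + j) + bot_mon i)%MM (top_mon i + bot_mon (d - 1 + j))%MM.
Proof.
move=> lti ltj; rewrite /top_mon /bot_mon lti ltnNge leq_addr /= addKn.
have [->|j_gt0] := posnP j.
  rewrite addn0 eqxx; apply: curve_order_deg.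
  by rewrite !mweightD mweightMn !mweight_mvar /off_last; do ?[case: ifP]; lia.
rewrite (_ : (d - 1 + j == d - 1) = false); last lia.
have [lt_i1|eq_i1] : (e + i).+1 < e + d - 1 \/ (e + i).+1 = e + d - 1 by lia.
  have lt_o : (e + i).+1 < e + d by lia.
  apply: (@curve_order_last _ _ (Ordinal lt_o)).
  - by rewrite !mweightD !mweight_mvar /off_last; do ?[case: ifP]; lia.
  - by rewrite !mdegD !mdeg_mvar; lia.
  - by rewrite !mnmDE !mvarE /=; lia.
  by move=> v /= ltv; rewrite !mnmDE !mvarE; lia.
by apply: curve_order_deg; rewrite !mweightD !mweight_mvar /off_last; do ?[case: ifP]; lia.
Qed.

Lemma lead_yy i j : i <= j -> j < e - 1 ->
  curve_order (top_mon (d - 1 + i) + bot_mon (d + j))%MM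
              (top_mon (d + j) + bot_mon (d - 1 + i))%MM.
Proof.
move=> le_ij ltj; rewrite /top_mon /bot_mon !(ltnNge _ (d - 1)) leq_addr /= addKn.
rewrite (_ : d - 1 <= d + j) /=; last lia.
rewrite (_ : (d + j == d - 1) = false); last lia.
(* For i = 0 the smaller term is x_(d-1)^e y_(j+1), of weight 1 against 2; otherwise y_(j+1) breaks
   the tie. *)
have [->|i_gt0] := posnP i.
  rewrite addn0 eqxx; apply: curve_order_deg.
  by rewrite !mweightD mweightMn !mweight_mvar /off_last; do ?[case: ifP]; lia.
rewrite (_ : (d - 1 + i == d - 1) = false); last lia.
have lt_o : j.+1 < e + d by lia.
apply: (@curve_order_last _ _ (Ordinal lt_o)).
- by rewrite !mweightD !mweight_mvar /off_last; do ?[case: ifP]; lia.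
- by rewrite !mdegD !mdeg_mvar; lia.
- by rewrite !mnmDE !mvarE /=; lia.
by move=> v /= ltv; rewrite !mnmDE !mvarE; lia.
Qed.

(** * Minors as binomials in the curve ideal, and their initial monomials *)

Section Minors.
Local Open Scope ring_scope.
Variable k : fieldType.
Local Notation M := (curve_matrix k d e).

Lemma curve_matrixE r (c : 'I_(d + e - 1)) :
  M r c = 'X_[if r == 0 then top_mon c else bot_mon c].
Proof.
have xE i : (i < d)%N -> xvar k d e i = 'X_[mvar _ (e + i)].
  by move=> lti; rewrite /xvar insubT -(mvar_ord (rshift e (Sub i lti))).
have yE j : (j < e)%N -> yvar k d e j = 'X_[mvar _ j].
  by move=> ltj; rewrite /yvar insubT -(mvar_ord (lshift d (Sub j ltj))).
have ltc := ltn_ord c; have eq_r : (r : nat) = (r != 0) by case: r => [[|[]]].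
rewrite mxE eq_r /top_mon /bot_mon; case: ifP => ltc1.
  by rewrite xE; [congr 'X_[_]; case: (r == 0); congr mvar => /=; lia | case: (r == 0) => /=; lia].
case: (altP (c =P d - 1 :> nat)%N) => [eqc|neqc].
  case: (r == 0); last by rewrite yE // eqc subnn.
  by rewrite xE -?mpolyXn ?addnBA //; lia.
by rewrite yE; [congr 'X_[_]; case: (r == 0); congr mvar => /=; lia | case: (r == 0) => /=; lia].
Qed.

Lemma minors2P (R : comNzRingType) n (A : 'M[R]_(2, n)) g :
  reflect (exists i j : 'I_n, (i < j)%N /\ g = A 0 i * A 1 j - A 0 j * A 1 i)
          (g \in minors2 A).
Proof.
have det2 (B : 'M[R]_2) : \det B = B 0 0 * B 1 1 - B 0 1 * B 1 0.
  rewrite (expand_det_row _ 0) big_ord_recl big_ord1 /cofactor !det_mx11 !mxE /=.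
  rewrite expr0 expr1 mul1r mulN1r mulrN.
  by congr (_ * B _ _ - B _ _ * B _ _); apply: val_inj.
apply: (iffP mapP) => [[[i j]]|[i [j [lt_ij ->]]]].
  by rewrite mem_filter /= => /andP[lt_ij _] ->; exists i, j; rewrite /= det2 !mxE.
exists (i, j); first by rewrite mem_filter lt_ij mem_enum.
by rewrite /= det2 !mxE.
Qed.

Lemma curve_minorP g :
  reflect (exists i j, [/\ (i < j < d + e - 1)%N &
             g = 'X_[(top_mon i + bot_mon j)] - 'X_[(top_mon j + bot_mon i)]])
          (g \in minors2 M).
Proof.
apply: (iffP (minors2P _ _)) => [[i [j [lt_ij ->]]]|[i [j [/andP[lt_ij ltj] ->]]]].
  by exists i, j; rewrite lt_ij ltn_ord !curve_matrixE !mpolyXD.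
exists (Ordinal (ltn_trans lt_ij ltj)), (Ordinal ltj).
by rewrite !curve_matrixE !mpolyXD.
Qed.

Definition param_mon (v : 'I_(e + d)) : 'X_{1..2} :=
  (U_(0%R) *+ spow v + U_(1%R) *+ tpow v)%MM.

Lemma curve_paramE v : curve_param k v = 'X_[param_mon v].
Proof.
rewrite /curve_param /param_mon mpolyXD -!mpolyXn /spow /tpow.
by case: splitP => i ->; rewrite ?addKn.
Qed.

Lemma curve_mapE f :
  curve_map f = mmap (@mpolyC 2 k) (fun v => 'X_[param_mon v]) f.
Proof.
apply: eq_bigr => m _; congr (_ * _); apply: eq_bigr => v _.
by rewrite curve_paramE.
Qed.

Lemma mimage_param_mon (m : 'X_{1..e + d}) : mimage param_mon m
  = (U_(0%R) *+ mweight (fun v => spow v) m + U_(1%R) *+ mweight (fun v => tpow v) m)%MM.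
Proof.
apply/mnmP=> i; rewrite mnm_sumE mnmDE !mulmnE !mnm1E /mweight !big_distrr /=.
rewrite -big_split /=; apply: eq_bigr => v _.
by rewrite mulmnE mnmDE !mulmnE !mnm1E mulnDl !mulnA.
Qed.

(** Turns a common fibre into the two weight equalities that [standard_least] takes. *)
Lemma mimage_param_inj (m m' : 'X_{1..e + d}) :
    mimage param_mon m = mimage param_mon m' ->
  mweight (fun v => spow v) m = mweight (fun v => spow v) m' /\
  mweight (fun v => tpow v) m = mweight (fun v => tpow v) m'.
Proof.
rewrite !mimage_param_mon => /mnmP eqm; split; [move: (eqm 0)|move: (eqm 1)];
  by rewrite !mnmDE !mulmnE !mnm1E /=; lia.
Qed.

Lemma minor_curve_ideal g : g \in minors2 M -> curve_ideal g.
Proof.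
case/curve_minorP=> i [j [/andP[lt_ij ltj] ->]].
rewrite /curve_ideal curve_mapE raddfB /= !mmapX !mmap1_mimage !mimage_param_mon.
rewrite !mweightD !top_bot_spow ?(ltn_trans lt_ij ltj) //.
rewrite !top_bot_tpow ?(ltn_trans lt_ij ltj) //.
apply/eqP; rewrite subr_eq0; apply/eqP; congr 'X_[(_ *+ _ + _ *+ _)]; lia.
Qed.

Definition minor_lead (m : 'X_{1..e + d}) : Prop :=
  exists2 g, g \in minors2 M & is_initial_monomial (@curve_order d e) g m.

Lemma minor_leadl i j : (i < j < d + e - 1)%N ->
    curve_order (top_mon j + bot_mon i)%MM (top_mon i + bot_mon j)%MM ->
  minor_lead (top_mon i + bot_mon j)%MM.
Proof.
move=> lt_ij lt_ji; eexists; first by apply/curve_minorP; exists i, j; split.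
exact: initial_binomial curve_order_irr lt_ji.
Qed.

Lemma minor_leadr i j : (i < j < d + e - 1)%N ->
    curve_order (top_mon i + bot_mon j)%MM (top_mon j + bot_mon i)%MM ->
  minor_lead (top_mon j + bot_mon i)%MM.
Proof.
move=> lt_ij lt_ji; eexists; first by apply/curve_minorP; exists i, j; split.
by rewrite -opprB; apply/initial_monomialN/initial_binomial/lt_ji/curve_order_irr.
Qed.

Lemma minor_lead_xx i j : (e < i)%N -> (i <= j)%N -> (j < e + d - 1)%N ->
  minor_lead (mvar _ i + mvar _ j)%MM.
Proof.
move=> lt_ei le_ij ltj.
(* Taking x_(i-e) as a bottom entry, one column to the left, keeps the two columns distinct even
   when i = j. *)
have -> : (mvar _ i + mvar _ j = top_mon (j - e) + bot_mon (i - e).-1)%MM.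
  rewrite addmC /top_mon /bot_mon !ifT; try lia.
  by congr (mvar _ _ + mvar _ _)%MM; lia.
by apply: minor_leadr; [lia | apply: lead_xx; lia].
Qed.

Lemma minor_lead_xy i j : (i < e)%N -> (e <= j)%N -> (j < e + d - 1)%N ->
  minor_lead (mvar _ i + mvar _ j)%MM.
Proof.
move=> lt_ie le_ej ltj.
have -> : (mvar _ i + mvar _ j = top_mon (j - e) + bot_mon (d - 1 + i))%MM.
  rewrite addmC /top_mon /bot_mon ifT; last lia; rewrite ifF; last lia.
  by congr (mvar _ _ + mvar _ _)%MM; lia.
by apply: minor_leadl; [lia | apply: lead_xy; lia].
Qed.

Lemma minor_lead_yy i j : (i <= j)%N -> (j < e - 1)%N ->
  minor_lead (mvar _ i + mvar _ j)%MM.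
Proof.
move=> le_ij ltj.
have -> : (mvar _ i + mvar _ j = top_mon (d + j) + bot_mon (d - 1 + i))%MM.
  rewrite addmC /top_mon /bot_mon !ifF; try lia.
  by congr (mvar _ _ + mvar _ _)%MM; lia.
by apply: minor_leadr; [lia | apply: lead_yy; lia].
Qed.

Lemma initial_curve_ideal (f : {mpoly k[e + d]}) m :
    curve_ideal f -> is_initial_monomial (@curve_order d e) f m ->
  exists2 m', minor_lead m' & (m' <= m)%MM.
Proof.
move=> If [fm max_m].
(* If no lead divides m, then m is least in its fibre, contradicting the second monomial of f that
   the kernel condition provides. Excluded middle is used because [minor_lead] is a [Prop]. *)
have [//|none] := classic (exists2 m', minor_lead m' & (m' <= m)%MM).
have free m' : minor_lead m' -> ~~ (m' <= m)%MM.
  by move=> lead_m'; apply/negP => le_m'm; apply: none; exists m'.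
move: If; rewrite /curve_ideal curve_mapE => f0.
have [m' fm' [ne_m'm /mimage_param_inj[eqS eqT]]] := monomial_map_kernel f0 fm.
suff: ~~ curve_order m' m by rewrite max_m.
apply: standard_least eqS eqT => //.
- by move=> i j ? ? ?; apply/free/minor_lead_xx.
- by move=> i j ? ? ?; apply/free/minor_lead_xy.
- by move=> i j ? ?; apply/free/minor_lead_yy.
Qed.

End Minors.

End Curve.

Theorem theorem4p1 (k : fieldType) (d e : nat) (hd : (1 <= d)%N) (he : (1 <= e)%N) :
  groebner_basis (@curve_order d e) (minors2 (curve_matrix k d e))
    (@curve_ideal k d e).
Proof.
split=> [g|h]; first exact: minor_curve_ideal.
split; apply: initial_ideal_mono => f m.
  move=> If fm; have [m' [g Mg gm'] le_m'm] := initial_curve_ideal hd he If fm.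
  by exists g, m'.
by move=> /(minor_curve_ideal hd he) If fm; exists f, m; split=> //; apply: lepm_refl.
Qed.
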